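(* Let $T$ be a tree with $\mathrm{diam}(T) \ge 2$, and let $l(T)$ be the number of leaves (vertices of degree one) of $T$. Then $\mathrm{gp}(S(T)) = 2\,l(T)$.
   Context: All graphs are finite. The shadow graph $S(G)$ of a graph $G$ is obtained from $G$ by adding, for each vertex $v$ of $G$, a new vertex $v'$ (the shadow vertex of $v$), and joining $v'$ to all neighbours of $v$ in $G$ (shadow vertices are pairwise non-adjacent). A set $S$ of vertices of a graph is a general position set if no three distinct vertices of $S$ lie on a common shortest path (geodesic); the general position number $\mathrm{gp}(H)$ is the maximum cardinality of a general position set of $H$. *)

(* Defs.v *)
From HB Require Import structures.
From mathcomp Require Import all_boot.
From mathcomp Require Import boolp.

Set Implicit Arguments.
Unset Strict Implicit.
Unset Printing Implicit Defensive.

Record sgraph := SGraph {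
  vertex :> finType;
  adj : rel vertex;
  adj_sym : symmetric adj;
  adj_irr : irreflexive adj
}.

Section Graph.
Variable G : sgraph.

Definition degree (x : G) : nat := #|[set y : G | adj x y]|.

Definition leaves : {set G} := [set x : G | degree x == 1].

Definition connected : Prop := forall x y : G, connect (@adj G) x y.

(* Closed [adj]-walks without repeated vertices and with at most two vertices
   are not cycles of a simple graph, hence the bound on the size. *)
Definition acyclic : Prop :=
  forall c : seq G, 2 < size c -> ~ ucycle (@adj G) c.

Definition tree : Prop := [/\ 0 < #|G|, connected & acyclic].

Definition has_walk (x y : G) (n : nat) : bool :=
  [exists p : n.-tuple G, path (@adj G) x p && (last x p == y)].

(* A shortest walk has fewer than #|G| edges, so the search is exhaustive; the
   value is #|G| when y is not reachable from x. *)
Definition gdist (x y : G) : nat := find (has_walk x y) (iota 0 #|G|).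

Definition diam : nat := \max_(x : G) \max_(y : G) gdist x y.

(* The vertex sequence x :: p is a shortest path from x to last x p. *)
Definition geodesic (x : G) (p : seq G) : Prop :=
  path (@adj G) x p /\ size p = gdist x (last x p).

Definition general_position (S : {set G}) : Prop :=
  forall u v w : G, u \in S -> v \in S -> w \in S -> uniq [:: u; v; w] ->
  ~ exists x p, geodesic x p /\ [/\ u \in x :: p, v \in x :: p & w \in x :: p].

Definition gp : nat := \max_(S : {set G} | `[< general_position S >]) #|S|.

Lemma has_walkP (x y : G) (n : nat) :
  reflect (exists p, [/\ size p = n, path (@adj G) x p & last x p = y])
          (has_walk x y n).
Proof.
apply: (iffP existsP) => [[p /andP[pp /eqP lp]]|[p [sp pp lp]]].
  by exists p; rewrite size_tuple.
by exists (Tuple (introT eqP sp)); rewrite /= pp lp eqxx.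
Qed.

Lemma gdist_min (x : G) (p : seq G) :
  path (@adj G) x p -> gdist x (last x p) <= size p.
Proof.
move=> pp; have [lt|] := ltnP (size p) #|G|; last first.
  by apply: leq_trans; rewrite -[leqRHS](size_iota 0); apply: find_size.
rewrite leqNgt; apply/negP => /(before_find 0).
have -> // : has_walk x (last x p) (nth 0 (iota 0 #|G|) (size p)) = true.
by apply/has_walkP; exists p; rewrite nth_iota.
Qed.

Lemma gdist_path (x y : G) : connect (@adj G) x y ->
  exists p, [/\ path (@adj G) x p, last x p = y & size p = gdist x y].
Proof.
case/connectP => p0 pp0 ->; case/shortenP: pp0 => p pp up _.
have lt : size p < #|G| by have := max_card (mem (x :: p)); rewrite (card_uniqP up).
have hw : has (has_walk x (last x p)) (iota 0 #|G|).
  apply/hasP; exists (size p); first by rewrite mem_iota.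
  by apply/has_walkP; exists p.
have := nth_find 0 hw; rewrite nth_iota ?add0n; last first.
  by rewrite -[ltnRHS](size_iota 0) -has_find.
by case/has_walkP => q [sq pq lq]; exists q.
Qed.

End Graph.

Section Shadow.
Variable G : sgraph.

(* [inl x] is the original vertex x, [inr x] is its shadow vertex x'. *)
Definition shadow_adj (u v : G + G) : bool :=
  match u, v with
  | inl x, inl y | inl x, inr y | inr x, inl y => adj x y
  | inr _, inr _ => false
  end.

Lemma shadow_adj_sym : symmetric shadow_adj.
Proof. by move=> [x|x] [y|y] //=; rewrite adj_sym. Qed.

Lemma shadow_adj_irr : irreflexive shadow_adj.
Proof. by move=> [x|x] //=; rewrite adj_irr. Qed.

Definition shadow : sgraph := SGraph shadow_adj_sym shadow_adj_irr.

End Shadow.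

(* Main.v *)
(** A set in general position contains no three vertices [a], [b], [c] with
    [d(a,c) = d(a,b) + d(b,c)].  In the shadow graph distances are those of the
    tree, except between a vertex and its own shadow and between the shadows of
    two adjacent vertices.  Hence the vertices and shadows of leaves are in
    general position, since a leaf is never between two other vertices.

    Conversely let [S] be in general position and let [k] be the number of
    leaves.  Above each geodesic between two leaves [S] has at most four
    elements, by inspection of the positions of five elements on a path.  Each
    vertex [v] of the tree lies on at least [2 (k - 1)] of the geodesics
    between the [k (k - 1)] ordered pairs of distinct leaves: splitting the
    leaves into those on one side of [v] and the others, of cardinals
    [a, b > 0], all [2 a b >= 2 (a + b - 1)] separated pairs qualify.  Double
    counting gives [#|S| * 2 (k - 1) <= 4 k (k - 1)]. *)

Require Import Defs.
From mathcomp Require Import all_boot.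
From mathcomp Require Import boolp zify.

Set Implicit Arguments.
Unset Strict Implicit.
Unset Printing Implicit Defensive.

(** * Distances, geodesics and general position in a connected graph *)

Section Metric.
Variable G : sgraph.
Hypothesis conG : connected G.
Implicit Types (x y z : G) (p : seq G) (S : {set G}).

Lemma gdist_lastP x y :
  exists p, [/\ path (@adj G) x p, last x p = y & size p = gdist x y].
Proof. exact: gdist_path. Qed.

Lemma gdistxx x : gdist x x = 0.
Proof. by apply/eqP; rewrite -leqn0; apply: (@gdist_min G x [::]). Qed.

Lemma gdist_eq0 x y : gdist x y = 0 -> x = y.
Proof.
move=> d0; have [p [_ lp]] := gdist_lastP x y.
by rewrite d0 => /size0nil p0; rewrite -lp p0.
Qed.

Lemma gdist_gt0 x y : x != y -> 0 < gdist x y.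
Proof. by rewrite lt0n; apply: contra_neq => /gdist_eq0. Qed.

Lemma gdist_triangle y x z : gdist x z <= gdist x y + gdist y z.
Proof.
have [p [pp lp <-]] := gdist_lastP x y; have [q [pq lq <-]] := gdist_lastP y z.
rewrite -size_cat -lq -lp -last_cat; apply: gdist_min.
by rewrite cat_path pp lp.
Qed.

Lemma gdist_sym x y : gdist x y = gdist y x.
Proof.
wlog suff: x y / gdist y x <= gdist x y.
  by move=> le; apply/eqP; rewrite eqn_leq !le.
have [p [pp lp <-]] := gdist_lastP x y.
have pr : path (@adj G) y (rev (belast x p)).
  by rewrite -lp rev_path (eq_path (e' := @adj G)) // => a b; rewrite adj_sym.
have := gdist_min pr; rewrite size_rev size_belast.
suff -> : last y (rev (belast x p)) = x by [].
case: p lp {pp pr} => [|a p] //= lp.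
by rewrite rev_cons last_rcons.
Qed.

Lemma gdist_adj x y : adj x y -> gdist x y = 1.
Proof.
move=> xy; apply/eqP; rewrite eqn_leq gdist_gt0; last first.
  by apply: contraTneq xy => ->; rewrite adj_irr.
by rewrite (@gdist_min G x [:: y]) //= xy.
Qed.

Lemma gdist_eq1 x y : gdist x y = 1 -> adj x y.
Proof.
move=> d1; have [p [pp lp]] := gdist_lastP x y; rewrite d1.
by case: p pp lp => [|a [|b p]] //= /andP[xa _] <-.
Qed.

Lemma gdist_towards x y : x != y ->
  exists2 z, adj x z & gdist y x = (gdist y z).+1.
Proof.
move=> nxy; have [p [pp lp sp]] := gdist_lastP x y.
case: p pp lp sp => [|z p] /=; first by move=> _ xy; rewrite xy eqxx in nxy.
move=> /andP[xz pp] lp sp; exists z => //.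
have := gdist_min pp; rewrite lp => le1.
have := gdist_triangle z x y; rewrite (gdist_adj xz) (gdist_sym y x).
by rewrite (gdist_sym y z); lia.
Qed.

(** By the triangle inequality, a shortcut between two positions would shorten the whole
    geodesic. *)
Lemma geodesic_nth x p i j : geodesic x p -> i <= j <= size p ->
  gdist (nth x (x :: p) i) (nth x (x :: p) j) = j - i.
Proof.
have nthE k : k <= size p -> nth x (x :: p) k = last x (take k p).
  move=> le; rewrite (last_nth x) size_takel //.
  by rewrite -[x :: take k p]/(take k.+1 (x :: p)) nth_take.
move=> [pp sp] /andP[ij jn].
have E : p = take i p ++ take (j - i) (drop i p) ++ drop j p.
  by rewrite -{1}(cat_take_drop j p) catA -takeD subnKC.
have Ej : take j p = take i p ++ take (j - i) (drop i p).
  by rewrite -takeD subnKC.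
rewrite !nthE ?(leq_trans ij) // Ej last_cat.
move: pp; rewrite {1}E !cat_path => /and3P[p1 p2 p3].
have := gdist_min p1; have := gdist_min p2; have := gdist_min p3.
rewrite -[last (last x (take i p)) _]last_cat -Ej -last_cat.
rewrite cat_take_drop size_drop.
rewrite !size_takel ?size_drop ?leq_sub2r ?(leq_trans ij) //.
set a := last x (take i p); set b := last x (take j p).
have := gdist_triangle a x (last x p); have := gdist_triangle b a (last x p).
by rewrite -sp; lia.
Qed.

Lemma geodesic_gdist_mem x p z : geodesic x p -> z \in x :: p ->
  gdist x (last x p) = gdist x z + gdist z (last x p).
Proof.
move=> gp zp; have le : index z (x :: p) <= size p by rewrite -ltnS index_mem.
have := geodesic_nth (i := 0) (j := index z (x :: p)) gp le.
have := geodesic_nth (i := index z (x :: p)) (j := size p) gp.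
rewrite le leqnn nth_index // -last_nth nth0 => /(_ isT) -> /= ->.
by case: gp => _ <-; move: le => /=; lia.
Qed.

Lemma general_position_gdist S a b c : general_position S ->
  a \in S -> b \in S -> c \in S -> uniq [:: a; b; c] ->
  gdist a c <> gdist a b + gdist b c.
Proof.
move=> gpS aS bS cS u E; apply: (gpS a b c) => //.
have [p [pp lp sp]] := gdist_lastP a b; have [q [pq lq sq]] := gdist_lastP b c.
exists a, (p ++ q); split.
  by rewrite /geodesic cat_path pp last_cat lp pq lq size_cat sp sq E.
rewrite -cat_cons !mem_cat mem_head; split=> //.
  by rewrite -lp mem_last.
rewrite -lq; case: q {pq lq sq} => [|d q] /=; first by rewrite -lp mem_last.
by rewrite mem_last orbT.
Qed.

(** Distances along a geodesic are differences of indices, so its vertices, sorted by index, add up;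
    the six orders of [u], [v], [w] reduce to [ordered]. *)
Lemma gdist_general_position S :
  (forall a b c, a \in S -> b \in S -> c \in S -> uniq [:: a; b; c] ->
     gdist a c <> gdist a b + gdist b c) ->
  general_position S.
Proof.
move=> H u v w uS vS wS uu [x [p [gp [up vp wp]]]].
pose idx z := index z (x :: p).
have lt z : z \in x :: p -> idx z <= size p by rewrite -ltnS -index_mem.
have dE y z : y \in x :: p -> z \in x :: p -> idx y <= idx z ->
    gdist y z = idx z - idx y.
  move=> yp zp yz; have := geodesic_nth (i := idx y) (j := idx z) gp.
  by rewrite !nth_index // yz lt // => /(_ isT).
have ordered a b c : a \in S -> b \in S -> c \in S ->
    a != b -> a != c -> b != c ->
    a \in x :: p -> b \in x :: p -> c \in x :: p ->
    idx a <= idx b -> idx b <= idx c -> False.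
  move=> aS bS cS ab ac bc ap bp cp le1 le2; apply: (H a b c) => //.
    by rewrite /= !inE negb_or ab ac bc.
  by rewrite !dE //; [rewrite addnC addnBA // subnK | apply: leq_trans le2].
move: uu; rewrite /= !inE negb_or andbT => /andP[/andP[uv uw] vw].
have [vu [wu wv]] : v != u /\ w != u /\ w != v.
  by rewrite ![_ == u]eq_sym [w == v]eq_sym.
have [l1|/ltnW l1] := leqP (idx u) (idx v);
have [l2|/ltnW l2] := leqP (idx v) (idx w).
- exact: (ordered u v w).
- have [l3|/ltnW l3] := leqP (idx u) (idx w).
    exact: (ordered u w v).
  exact: (ordered w u v).
- have [l3|/ltnW l3] := leqP (idx u) (idx w).
    exact: (ordered v u w).
  exact: (ordered v w u).
- exact: (ordered w v u).
Qed.

End Metric.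

(** * Cut vertices and betweenness in a tree *)

Section Tree.
Variable T : sgraph.
Hypothesis hT : tree T.
Implicit Types (v x y z : T) (p q : seq T).

Let conT : connected T. Proof. by case: hT. Qed.

(** A path from [a] to [b] avoiding [v], once shortened, would close up through [v] to a cycle. *)
Lemma neighbours_separated v a b p : adj v a -> adj v b -> a != b ->
  path (@adj T) a p -> last a p = b -> v \in a :: p.
Proof.
move=> va vb; have [_ _ acy] := hT.
move=> nab pp lp; apply: contraNT nab => vp; apply/eqP.
case/shortenP: pp lp vp => {}p' pp up sub lp vp.
have vp' : v \notin a :: p'.
  by apply: contra vp; rewrite !inE => /orP[->|/sub ->] //; rewrite orbT.
case: p' lp pp up {sub vp} vp' => [|c p'] // lp pp up vp.
exfalso; apply: (acy [:: v, a, c & p']) => //; apply/andP; split.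
  by move: lp pp; rewrite (cycle_path v) /= => -> ->; rewrite adj_sym vb va.
by rewrite cons_uniq vp.
Qed.

(** Shortest paths from [a] to [x] and from [y] to [b] avoid [v]. Joined to [p] they form a walk
    from [a] to [b], which has to meet [v], hence does so in [p]. *)
Lemma cut_vertex v a b x y p : adj v a -> adj v b -> a != b ->
  gdist x a < gdist x v -> gdist y b < gdist y v ->
  path (@adj T) x p -> last x p = y -> v \in x :: p.
Proof.
move=> va vb nab xa yb pp lp.
have [q [pq lq sq]] := gdist_lastP conT a x.
have [r [pr lr sr]] := gdist_lastP conT y b.
have vq : v \notin a :: q.
  apply/negP => /(geodesic_gdist_mem conT (conj pq _)); rewrite lq => /(_ sq).
  by rewrite (gdist_sym conT a x) (gdist_sym conT v x); lia.
have vr : v \notin y :: r.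
  apply/negP => /(geodesic_gdist_mem conT (conj pr _)); rewrite lr => /(_ sr).
  by lia.
have := @neighbours_separated v a b (q ++ p ++ r) va vb nab.
rewrite !cat_path !last_cat lq lp lr pq pp pr => /(_ isT erefl).
rewrite -cat_cons mem_cat (negbTE vq) mem_cat inE /= => /orP[->|vr'].
  by rewrite orbT.
by rewrite inE vr' orbT in vr.
Qed.

Lemma cut_vertex_gdist v a b x y : adj v a -> adj v b -> a != b ->
  gdist x a < gdist x v -> gdist y b < gdist y v ->
  gdist x y = gdist x v + gdist v y.
Proof.
move=> va vb nab xa yb; have [p [pp lp sp]] := gdist_lastP conT x y.
have := cut_vertex va vb nab xa yb pp lp.
by move/(geodesic_gdist_mem conT (conj pp _)); rewrite lp; apply.
Qed.

Lemma between_mem_path v x y p : gdist x y = gdist x v + gdist v y ->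
  path (@adj T) x p -> last x p = y -> v \in x :: p.
Proof.
move=> E pp lp.
have [->|nvx] := eqVneq v x; first exact: mem_head.
have [->|nvy] := eqVneq v y; first by rewrite -lp mem_last.
have [a va xa] := gdist_towards conT nvx; have [b vb yb] := gdist_towards conT nvy.
apply: (cut_vertex va vb) pp lp; rewrite ?xa ?yb ?leqnn //.
(* If both geodesics left [v] through the same neighbour, bypassing [v] would save two edges. *)
apply/eqP => ab; have := gdist_triangle conT a x y.
rewrite E xa (gdist_sym conT v y) yb ab (gdist_sym conT b y); lia.
Qed.

Lemma leaf_beyond v a : adj v a ->
  exists2 x, x \in leaves T & gdist x a < gdist x v.
Proof.
move=> va; pose P x := gdist x a < gdist x v.
have Pa : P a.
  by rewrite /P gdistxx gdist_gt0 //; apply: contraTneq va => ->; rewrite adj_irr.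
(* A vertex farthest from [v] on the side of [a] is a leaf: any neighbour other than the one towards
   [v] would be farther still, on the same side. *)
case: (arg_maxnP (fun x => gdist x v) Pa) => x Px xmax; exists x => //.
have nxv : x != v by apply: contraTneq Px => ->; rewrite /P gdistxx.
have [w xw dw] := gdist_towards conT nxv.
rewrite inE; apply/cards1P; exists w; apply/setP => z; rewrite !inE.
apply/idP/eqP => [xz|-> //]; apply/eqP; apply: contraTT isT => nzw.
have zx : 0 < gdist z x by rewrite (gdist_sym conT) gdist_adj.
have E : gdist v z = gdist v x + gdist x z.
  by apply: (cut_vertex_gdist xw xz); rewrite 1?eq_sym ?dw ?gdistxx.
have /= := xmax z; rewrite /P; have := gdist_triangle conT x z a.
move: Px; rewrite /P (gdist_sym conT z v) E (gdist_sym conT v x).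
by rewrite (gdist_sym conT z x) (gdist_adj conT xz); lia.
Qed.

Lemma leaf_neighbour_unique v a b : v \in leaves T -> adj v a -> adj v b -> a = b.
Proof.
rewrite inE => /cards1P[w nv] va vb.
have: a \in [set w] by rewrite -nv inE.
have: b \in [set w] by rewrite -nv inE.
by move=> /set1P -> /set1P ->.
Qed.

(** Both geodesics reach [v] through its only neighbour, so the detour to [v] costs two edges. *)
Lemma leaf_gdist v x y : v \in leaves T -> x != v -> y != v ->
  gdist x y < gdist x v + gdist v y.
Proof.
rewrite ![_ == v]eq_sym => vl nx ny.
have [a va xa] := gdist_towards conT nx; have [b vb yb] := gdist_towards conT ny.
rewrite (leaf_neighbour_unique vl vb va) in yb.
have := gdist_triangle conT a x y.
by rewrite xa (gdist_sym conT v y) yb (gdist_sym conT a y); lia.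
Qed.

(** * Pairs of leaves separated by a vertex *)

Hypothesis hd : 2 <= diam T.

Lemma exists_gdist_ge2 : exists x y, 2 <= gdist x y.
Proof.
suff /existsP[x /existsP[y xy]] : [exists x : T, exists y : T, 2 <= gdist x y].
  by exists x, y.
apply: contraLR hd; rewrite negb_exists -leqNgt => /forallP H.
apply/bigmax_leqP => x _; apply/bigmax_leqP => y _; rewrite leqNgt.
by have := H x; rewrite negb_exists => /forallP.
Qed.

Lemma exists_neighbour v : exists a, adj v a.
Proof.
have [x [y xy]] := exists_gdist_ge2.
have [vx|vx] := eqVneq v x; last by have [a] := gdist_towards conT vx; exists a.
have vy : v != y by apply: contraTneq xy => vy; rewrite -vx -vy gdistxx.
by have [a] := gdist_towards conT vy; exists a.
Qed.

Lemma leaves_nonadjacent x y : x \in leaves T -> y \in leaves T -> ~~ adj x y.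
Proof.
move=> xl yl; apply/negP => xy; have yx : adj y x by rewrite adj_sym.
(* Two adjacent leaves would make up the whole tree, of diameter one. *)
have only z : z = x \/ z = y.
  have [->|xz] := eqVneq x z; first by left.
  have [->|yz] := eqVneq y z; first by right.
  have [a xa za] := gdist_towards conT xz; have [b yb zb] := gdist_towards conT yz.
  rewrite (leaf_neighbour_unique xl xa xy) in za.
  rewrite (leaf_neighbour_unique yl yb yx) in zb; lia.
have [u [w]] := exists_gdist_ge2.
by case: (only u) => ->; case: (only w) => ->; rewrite ?gdistxx ?gdist_adj.
Qed.

(* [A] consists of the leaves on one side of [v], or of [v] if it is a leaf. *)
Lemma leaf_separation v : exists A : {set T},
  [/\ A \subset leaves T, A != set0, leaves T :\: A != set0
    & forall x y, x \in A -> y \in leaves T :\: A ->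
        gdist x y = gdist x v + gdist v y].
Proof.
have [a va] := exists_neighbour v.
have [x xl xa] := leaf_beyond va.
have nxv : x != v by apply: contraTneq xa => ->; rewrite gdistxx.
have [vl|vl] := boolP (v \in leaves T).
  exists [set v]; split; first by rewrite sub1set.
  - by apply/set0Pn; exists v; rewrite inE.
  - by apply/set0Pn; exists x; rewrite !inE nxv; rewrite inE in xl.
  - by move=> y z /set1P -> _; rewrite gdistxx.
have [b vb nab] : exists2 b, adj v b & a != b.
  have: 1 < degree v.
    rewrite ltn_neqAle eq_sym; rewrite inE in vl; rewrite vl.
    by apply/card_gt0P; exists a; rewrite inE.
  rewrite /degree (cardsD1 a) inE va => /card_gt0P[b].
  by rewrite !inE => /andP[nba vb]; exists b; rewrite // eq_sym.
have [y yl yb] := leaf_beyond vb.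
exists [set x in leaves T | gdist x a < gdist x v]; split.
- by apply/subsetP => z; rewrite inE => /andP[].
- by apply/set0Pn; exists x; rewrite inE xl.
- apply/set0Pn; exists y; rewrite !inE negb_and; move: (yl); rewrite inE => ->.
  rewrite andbT /=; apply/negP => ya.
  (* The trivial path at [y]: a vertex on the sides of both [a] and [b] would be [v] itself. *)
  have := cut_vertex va vb nab ya yb (p := [::]) isT erefl.
  by rewrite inE => /eqP vy; rewrite vy gdistxx in ya.
- move=> s t; rewrite inE => /andP[_ sa].
  rewrite 2!inE => /andP[nt tl]; rewrite tl /= -leqNgt in nt.
  have nvt : v != t by apply: contraNneq vl => ->.
  have [c vc tc] := gdist_towards conT nvt.
  apply: (cut_vertex_gdist va vc) => //; last by rewrite tc.
  by apply/eqP => ac; rewrite ac tc ltnn in nt.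
Qed.

Lemma card_leaves_gt1 : 1 < #|leaves T|.
Proof.
have [/card_gt0P[v _] _ _] := hT; have [A [Al A0 B0 _]] := leaf_separation v.
rewrite -(cardsID A (leaves T)) (setIidPr Al); rewrite -!card_gt0 in A0 B0.
by rewrite -[2]/(1 + 1) leq_add.
Qed.

Definition leaf_pairs v := [set e in setX (leaves T) (leaves T) |
  (e.1 != e.2) && (gdist e.1 e.2 == gdist e.1 v + gdist v e.2)].

Lemma card_leaf_pairs v : 2 * (#|leaves T| - 1) <= #|leaf_pairs v|.
Proof.
have [A [Al A0 B0 sep]] := leaf_separation v; set B := _ :\: A in B0 sep.
have AB : #|A| + #|B| = #|leaves T|.
  by rewrite -(cardsID A (leaves T)) (setIidPr Al).
have dis x y : x \in A -> y \in B -> x != y.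
  by move=> xA; rewrite inE => /andP[yA _]; apply: contraNneq yA => <-.
have sub : setX A B :|: setX B A \subset leaf_pairs v.
  apply/subsetP => -[x y]; rewrite in_setU !in_setX => /orP[] /andP[xA yB].
    have yl : y \in leaves T by move: yB; rewrite inE => /andP[].
    by rewrite inE in_setX (subsetP Al) //= yl dis // (sep x y) /=.
  have xl : x \in leaves T by move: xA; rewrite inE => /andP[].
  rewrite inE in_setX xl (subsetP Al) //= eq_sym dis //.
  rewrite (gdist_sym conT) (sep y x) // addnC.
  by rewrite (gdist_sym conT y) (gdist_sym conT x) /=.
apply: leq_trans (subset_leq_card sub).
have dAB : [disjoint setX A B & setX B A].
  rewrite -setI_eq0; apply/eqP/setP => -[x y]; rewrite !inE /=.
  by case: (x \in A); case: (y \in A); rewrite ?andbF.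
rewrite cardsU (_ : _ :&: _ = set0) ?cards0 ?subn0 ?cardsX; last first.
  by apply/eqP; rewrite setI_eq0.
rewrite -AB -!card_gt0 in A0 B0 *; nia.
Qed.

End Tree.

(* The number [i] encodes the point of abscissa [i./2] on a path, or its shadow
   if [i] is odd.  Three points in this order lie on a geodesic unless two
   consecutive ones are shadows of adjacent vertices. *)
Lemma size_sparse_codes (s : seq nat) : uniq s ->
  (forall i j k, i \in s -> j \in s -> k \in s -> i./2 < j./2 < k./2 ->
     [&& odd i, odd j & j./2 == i./2.+1] || [&& odd j, odd k & k./2 == j./2.+1]) ->
  size s <= 4.
Proof.
move=> us H; rewrite leqNgt; apply/negP => ss.
have: sorted ltn (sort leq s).
  by rewrite ltn_sorted_uniq_leq sort_uniq us sort_sorted //; apply: leq_total.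
have: size (sort leq s) > 4 by rewrite size_sort.
have {H}: forall i j k, i \in sort leq s -> j \in sort leq s -> k \in sort leq s ->
     i./2 < j./2 < k./2 ->
     [&& odd i, odd j & j./2 == i./2.+1] || [&& odd j, odd k & k./2 == j./2.+1].
  by move=> i j k; rewrite !mem_sort; apply: H.
case: (sort leq s) => [|a [|b [|c [|d [|e t]]]]] //= H _.
case/and5P => ab bc cd de _.
(* At most two codes share a half, so [a], [c], [e] have distinct halves. If [a] and [c] are shadows
   of adjacent points, [b] is the original below [c], and [a], [b], [e] violate the condition.
   Otherwise [c] and [e] are such shadows, [d] is the original below [e], and [a], [c], [d] lead
   back to the first case. *)
have := (H a c e, H a c d, H a b e).
rewrite !inE !eqxx ?orbT => -[[/(_ isT isT isT) ace /(_ isT isT isT) acd]].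
move=> /(_ isT isT isT) abe {H us ss t s}; move: ace acd abe ab bc cd de.
move: (odd_double_half a) (odd_double_half b) (odd_double_half c).
move: (odd_double_half d) (odd_double_half e).
move: (odd a) (odd b) (odd c) (odd d) (odd e) => oa ob oc od oe.
move: a./2 b./2 c./2 d./2 e./2 => ha hb hc hd he <- <- <- <- <-.
case: oa; case: ob; case: oc; case: od; case: oe; rewrite /= ?orbF ?add0n; lia.
Qed.

(** * Distances in the shadow graph *)

Section Shadow.
Local Arguments adj : simpl never.
Variable T : sgraph.
Hypothesis hT : tree T.
Hypothesis hd : 2 <= diam T.

Let conT : connected T. Proof. by case: hT. Qed.

Definition base (u : shadow T) : T := match u with inl x | inr x => x end.

Definition is_shadow (u : shadow T) : bool := if u is inr _ then true else false.

Implicit Types (u v w : shadow T) (x y : T).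

Lemma base_shadow_inj u v : base u = base v -> is_shadow u = is_shadow v -> u = v.
Proof. by case: u v => [x|x] [y|y] //= ->. Qed.

Lemma shadow_adjE u v :
  adj u v = adj (base u) (base v) && ~~ (is_shadow u && is_shadow v).
Proof. by case: u v => [x|x] [y|y] //=; rewrite ?andbT ?andbF. Qed.

Lemma base_path u (p : seq (shadow T)) :
  path (@adj (shadow T)) u p -> path (@adj T) (base u) (map base p).
Proof.
elim: p u => [|v p IH] u //= /andP[]; rewrite shadow_adjE => /andP[-> _].
exact: IH.
Qed.

Lemma path_inl x (p : seq T) :
  path (@adj (shadow T)) (inl x) (map inl p) = path (@adj T) x p.
Proof. by rewrite path_map. Qed.

Lemma shadow_connected : connected (shadow T).
Proof.
have cs : connect_sym (@adj (shadow T)) by apply/sym_connect_sym/adj_sym.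
have toinl u : exists x, connect (@adj (shadow T)) u (inl x).
  have [x ux] := exists_neighbour hT hd (base u).
  by exists x; apply: connect1; rewrite shadow_adjE ux /= andbF.
move=> u v; have [x ux] := toinl u; have [y vy] := toinl v.
rewrite cs in vy; apply: connect_trans ux (connect_trans _ vy).
have /connectP[p pp ->] := conT x y.
by apply/connectP; exists (map inl p); rewrite ?path_inl // last_map.
Qed.

Let conS := shadow_connected.

Lemma gdist_base_le u v : gdist (base u) (base v) <= gdist u v.
Proof.
have [p [pp <- <-]] := gdist_lastP conS u v.
by have := gdist_min (base_path pp); rewrite last_map size_map.
Qed.

(** A tree geodesic lifts with all its interior vertices original; this fails only for a single edge
    between two shadows. The other inequality comes from projection to the tree. *)
Lemma gdist_shadow u v : base u != base v ->
  ~~ [&& is_shadow u, is_shadow v & adj (base u) (base v)] ->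
  gdist u v = gdist (base u) (base v).
Proof.
move=> nuv nadj; apply/eqP; rewrite eqn_leq gdist_base_le andbT.
have [p [pp lp <-]] := gdist_lastP conT (base u) (base v).
case/lastP: p pp lp => [|p y] pp lp; first by rewrite -lp eqxx in nuv.
rewrite last_rcons in lp; rewrite {}lp rcons_path in pp.
rewrite size_rcons -(size_map (@inl T T)) -(size_rcons _ v).
rewrite -[v in gdist u v](last_rcons u (map inl p) v); apply: gdist_min.
case: p pp => [|z p] /=.
  move=> uv; rewrite uv andbT in nadj.
  by rewrite andbT shadow_adjE uv.
move=> /andP[/andP[uz pp] zv]; rewrite rcons_path [adj u _]shadow_adjE uz andbF /=.
by rewrite path_inl pp last_map shadow_adjE zv.
Qed.

(** * Upper bound by double counting *)

Lemma card_on_geodesic (S : {set shadow T}) x y : general_position S ->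
  #|[set u in S | gdist x y == gdist x (base u) + gdist (base u) y]| <= 4.
Proof.
move=> gpS; set B := [set u in S | _].
have [p [pp lp sp]] := gdist_lastP conT x y.
have gp : geodesic x p by split; rewrite // lp.
have Bp u : u \in B -> base u \in x :: p.
  by rewrite inE => /andP[_ /eqP E]; apply: (between_mem_path hT E).
have BS u : u \in B -> u \in S by rewrite inE => /andP[].
pose idx u := index (base u) (x :: p).
have dT u v : u \in B -> v \in B -> idx u < idx v ->
    gdist (base u) (base v) = idx v - idx u.
  move=> uB vB uv; have := geodesic_nth conT (i := idx u) (j := idx v) gp.
  rewrite (nth_index _ (Bp u uB)) (nth_index _ (Bp v vB)) (ltnW uv) /=.
  by rewrite -ltnS index_mem; apply; apply: Bp.
have dE u v : u \in B -> v \in B -> idx u < idx v ->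
    ~~ [&& is_shadow u, is_shadow v & idx v == (idx u).+1] ->
    gdist u v = idx v - idx u.
  move=> uB vB uv sh; rewrite gdist_shadow ?dT //.
    by apply: contraTneq uv => E; rewrite /idx E ltnn.
  apply: contra sh => /and3P[-> -> /(gdist_adj conT)]; rewrite dT //=; lia.
(* Position on the path and shadow bit determine [u], so [code] is injective on [B]. *)
pose code u := is_shadow u + (idx u).*2.
have codeK u : (odd (code u) = is_shadow u) * ((code u)./2 = idx u).
  by rewrite /code oddD odd_double addbF oddb half_bit_double.
rewrite cardE -(size_map code); apply: size_sparse_codes.
  rewrite map_inj_in_uniq ?enum_uniq // => u v; rewrite !mem_enum => uB vB E.
  have /(congr1 (nth x (x :: p))) : idx u = idx v by rewrite -!codeK E.
  rewrite /idx !nth_index ?Bp // => /base_shadow_inj; apply.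
  by rewrite -!codeK E.
move=> _ _ _ /mapP[u uB ->] /mapP[v vB ->] /mapP[w wB ->]; rewrite !codeK.
rewrite !mem_enum in uB vB wB; move=> /andP[uv vw].
have uw := ltn_trans uv vw.
apply: contraT; rewrite negb_or => /andP[nuv nvw].
case: (general_position_gdist conS gpS (BS u uB) (BS v vB) (BS w wB)).
  have ne a b : idx a < idx b -> a != b by apply: contraTneq => ->; rewrite ltnn.
  by rewrite /= !inE negb_or !ne.
rewrite (dE u v) // (dE v w) // (dE u w) //; first lia.
(* The outer vertices [u] and [w] are at least two positions apart, so their bases are not
   adjacent. *)
by apply/negP => /and3P[_ _ /eqP]; lia.
Qed.

Lemma card_general_position (S : {set shadow T}) :
  general_position S -> #|S| <= 2 * #|leaves T|.
Proof.
move=> gpS; set k := #|leaves T|; have k2 : 1 < k := card_leaves_gt1 hT hd.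
pose D := [set e in setX (leaves T) (leaves T) | e.1 != e.2].
have cD : #|D| = k * k - k.
  have -> : D = setX (leaves T) (leaves T) :\: [set (x, x) | x in leaves T].
    apply/setP => -[x y]; rewrite in_setD in_set andbC.
    case: (boolP ((x, y) \in setX _ _)) => [|_]; last by rewrite !andbF.
    rewrite in_setX !andbT => /andP[xl _]; congr (~~ _).
    by apply/eqP/imsetP => /= [<-|[z _ [-> ->]]] //; exists x.
  rewrite cardsD cardsX (setIidPr _) ?card_imset // => [x y []//|].
  by apply/subsetP => _ /imsetP[x xl ->]; rewrite in_setX xl.
have lo : #|S| * (2 * (k - 1)) <= \sum_(u in S) #|leaf_pairs (base u)|.
  by rewrite -sum_nat_const; apply: leq_sum => u _; apply: card_leaf_pairs.
have hi : \sum_(u in S) #|leaf_pairs (base u)| <= #|D| * 4.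
  have E u : #|leaf_pairs (base u)| = \sum_(e in D |
      gdist e.1 e.2 == gdist e.1 (base u) + gdist (base u) e.2) 1.
    by rewrite -sum1_card; apply: eq_bigl => e; rewrite !inE andbA.
  rewrite -sum_nat_const (eq_bigr _ (fun u _ => E u)).
  (* Summing over pairs of leaves first, each pair in [D] counts the elements of [S] above its
     geodesic. *)
  rewrite (exchange_big_dep (mem D)) /=; last by move=> u e _ /andP[].
  apply: leq_sum => e eD.
  apply: leq_trans (card_on_geodesic e.1 e.2 gpS).
  rewrite -sum1_card; apply/eq_leq/eq_bigl => u; rewrite !inE.
  by move: eD; rewrite !inE => ->.
(* The factor [2 * (k - 1)] cancels because [1 < k]. *)
have := leq_trans lo hi; rewrite cD; nia.
Qed.

(** * Lower bound from the leaves and their shadows *)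

Definition lifted_leaves : {set shadow T} := [set u | base u \in leaves T].

Lemma card_lifted_leaves : #|lifted_leaves| = 2 * #|leaves T|.
Proof.
have -> : lifted_leaves = inl @: leaves T :|: inr @: leaves T.
  apply/setP => -[] x; rewrite !inE /=.
    rewrite mem_imset; last by move=> ? ? [].
    by rewrite inE orbC; case: imsetP => // -[].
  rewrite [X in _ || X]mem_imset; last by move=> ? ? [].
  by rewrite inE; case: imsetP => // -[].
rewrite cardsU (_ : _ :&: _ = set0); last first.
  by apply/setP => u; rewrite !inE; apply/andP => -[/imsetP[x _ ->] /imsetP[]].
by rewrite cards0 subn0 !card_imset ?addnn ?mul2n // => ? ? [].
Qed.

Lemma lifted_leaves_general_position : general_position lifted_leaves.
Proof.
apply: (gdist_general_position conS) => a b c.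
rewrite !inE -![degree _ == 1](in_set (fun x => degree x == 1)) => al bl cl.
move=> /andP[]; rewrite !inE negb_or => /andP[ab ac] /andP[bc _].
have dE u v : base u \in leaves T -> base v \in leaves T -> base u != base v ->
    gdist u v = gdist (base u) (base v) /\ 1 < gdist u v.
  move=> ul vl uv; have nadj := leaves_nonadjacent hT hd ul vl.
  rewrite gdist_shadow ?(negbTE nadj) ?andbF //; split=> //.
  rewrite ltn_neqAle gdist_gt0 // andbT; apply: contraNneq nadj => d1.
  exact: gdist_eq1.
have abp := gdist_gt0 conS ab; have bcp := gdist_gt0 conS bc.
(* If [a] and [c] lie over one leaf, they have a common neighbour, while [b] lies over another leaf
   and is at distance at least two from each. *)
have [eac|nac] := eqVneq (base a) (base c).
  have [x ax] := exists_neighbour hT hd (base a).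
  have le2 : gdist a c <= 2.
    rewrite -[2]/(size [:: inl x : shadow T; c]).
    rewrite (_ : c = last a [:: inl x : shadow T; c]) //; apply: gdist_min.
    rewrite /= andbT [adj a _]shadow_adjE ax andbF /=.
    by rewrite shadow_adjE -eac adj_sym ax.
  have [eab|nab] := eqVneq (base a) (base b).
    move: eac eab ab ac bc; case: (a) (b) (c) => [?|?] [?|?] [?|?] /= -> -> //;
      rewrite ?eqxx //.
  have nbc : base b != base c by rewrite -eac eq_sym.
  have [_] := dE _ _ al bl nab; have [_] := dE _ _ bl cl nbc; lia.
have [-> _] := dE _ _ al cl nac.
(* If [b] shares its base with [a] or [c], replacing one by the other leaves the distance to the
   third vertex unchanged, so the positive distance between them is in excess. *)
have [eab|nab] := eqVneq (base a) (base b).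
  by rewrite eab in nac *; have [-> _] := dE _ _ bl cl nac; lia.
have [ebc|nbc] := eqVneq (base b) (base c).
  by rewrite -ebc; have [-> _] := dE _ _ al bl nab; lia.
have [-> _] := dE _ _ al bl nab; have [-> _] := dE _ _ bl cl nbc.
have cb : base c != base b by rewrite eq_sym.
by have := leaf_gdist hT bl nab cb; lia.
Qed.

End Shadow.

Theorem theorem3p9 (T : sgraph) (hT : tree T) (hd : 2 <= diam T) :
  gp (shadow T) = 2 * #|leaves T|.
Proof.
apply/eqP; rewrite eqn_leq; apply/andP; split.
  by apply/bigmax_leqP => S /asboolP; apply: card_general_position.
rewrite -card_lifted_leaves; apply: leq_bigmax_cond.
by apply/asboolP; apply: lifted_leaves_general_position.
Qed.
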